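(* Let $G$ be a finite group. There is an action of the special linear group $\operatorname{SL}(2,\mathbb{Z})$ on the set $G(1)=\{(g,k)\in G\times G : [k,g]=1\}$, in which the matrices $\begin{pmatrix}1&0\\1&1\end{pmatrix}$ and $\begin{pmatrix}0&1\\-1&0\end{pmatrix}$ act by $(g,k)\mapsto(g,kg)$ and $(g,k)\mapsto(k,g^{-1})$ respectively, and whose number of orbits is equal to $r_1(G)$.
   Context: For a finite group $G$, $G(1)=\{(g,k)\in G\times G : [k,g]=1\}$ is the set of commuting pairs. Consider the graph with vertex set $G(1)$ whose edges are given by the identifications $(g,k)\sim(g,kg^m)$ for $m\in\mathbb{Z}$, and $(g,k)\sim(gkg^{-1},g^{-1})=(k,g^{-1})$. The number $r_1(G)$ is the number of connected components of this graph. *)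

(* Defs.v *)
From HB Require Import structures.
From mathcomp Require Import all_boot all_order all_algebra all_fingroup.
From mathcomp Require Import boolp.

Set Implicit Arguments.
Unset Strict Implicit.
Unset Printing Implicit Defensive.

Import GRing.Theory.

Definition mx2 (R : Type) (a b c d : R) : 'M[R]_2 :=
  (\matrix_(i, j) if i == 0 then (if j == 0 then a else b)
                  else (if j == 0 then c else d))%R.

Lemma det_mx2 (R : comNzRingType) (a b c d : R) :
  (\det (mx2 a b c d) = a * d - b * c)%R.
Proof.
rewrite (expand_det_row _ ord0) !big_ord_recl big_ord0 /cofactor !det_mx11 !mxE.
by rewrite /= expr0 expr1 mul1r mulN1r mulrN addr0.
Qed.

Record SL2Z := MkSL2Z { SL2Z_mx :> 'M[int]_2; _ : (\det SL2Z_mx == 1)%R }.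

HB.instance Definition _ := [isSub for SL2Z_mx].
HB.instance Definition _ := [Choice of SL2Z by <:].

Section SL2ZGroup.
Implicit Types A B : SL2Z.

Lemma SL2Z_det A : (\det A = 1)%R.
Proof. exact/eqP/(valP A). Qed.

Fact SL2Z_one_subproof : (\det (1%:M : 'M[int]_2) == 1)%R.
Proof. by rewrite det1. Qed.

Fact SL2Z_mul_subproof A B : (\det (A *m B) == 1)%R.
Proof. by rewrite det_mulmx !SL2Z_det mulr1. Qed.

Fact SL2Z_inv_subproof A : (\det (\adj A) == 1)%R.
Proof.
have := congr1 determinant (mul_mx_adj A).
by rewrite det_mulmx SL2Z_det mul1r det1 => ->.
Qed.

Definition SL2Z_one : SL2Z := MkSL2Z SL2Z_one_subproof.
Definition SL2Z_mul A B : SL2Z := MkSL2Z (SL2Z_mul_subproof A B).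
(* The adjugate is the inverse, since the determinant is 1. *)
Definition SL2Z_inv A : SL2Z := MkSL2Z (SL2Z_inv_subproof A).

Fact SL2Z_mulA : associative SL2Z_mul.
Proof. by move=> A B C; apply: val_inj; exact: mulmxA. Qed.

Fact SL2Z_mul1 : left_id SL2Z_one SL2Z_mul.
Proof. by move=> A; apply: val_inj; exact: mul1mx. Qed.

Fact SL2Z_mulr1 : right_id SL2Z_one SL2Z_mul.
Proof. by move=> A; apply: val_inj; exact: mulmx1. Qed.

Fact SL2Z_mulV : left_inverse SL2Z_one SL2Z_inv SL2Z_mul.
Proof. by move=> A; apply: val_inj; rewrite /= mul_adj_mx SL2Z_det. Qed.

Fact SL2Z_mulrV : right_inverse SL2Z_one SL2Z_inv SL2Z_mul.
Proof. by move=> A; apply: val_inj; rewrite /= mul_mx_adj SL2Z_det. Qed.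

End SL2ZGroup.

HB.instance Definition _ :=
  isGroup.Build SL2Z SL2Z_mulA SL2Z_mul1 SL2Z_mulr1 SL2Z_mulV SL2Z_mulrV.

Fact SL2Z_T_subproof : (\det (mx2 1 0 1 1 : 'M[int]_2) == 1)%R.
Proof. by rewrite det_mx2. Qed.

Fact SL2Z_S_subproof : (\det (mx2 0 1 (-1) 0 : 'M[int]_2) == 1)%R.
Proof. by rewrite det_mx2. Qed.

Definition SL2Z_T : SL2Z := MkSL2Z SL2Z_T_subproof.
Definition SL2Z_S : SL2Z := MkSL2Z SL2Z_S_subproof.

Local Open Scope group_scope.

(* The library's actions require a finite acting group and act on the right. *)
Definition is_left_action (aT : groupType) (T : Type) (to : aT -> T -> T) :=
  (forall x, to 1 x = x) /\ (forall a b x, to (a * b) x = to a (to b x)).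

Definition num_orbits (aT : groupType) (T : finType) (to : aT -> T -> T) :=
  #|[set [set y | `[< exists a, y = to a x >]] | x : T]|.

Definition expgz (gT : groupType) (x : gT) (m : int) : gT :=
  match m with Posz n => x ^+ n | Negz n => x ^- n.+1 end.

Section CommutingPairs.
Variables (gT : finGroupType) (G : {group gT}).

Definition commuting_pairs : {set gT * gT} :=
  [set p in setX G G | [~ p.2, p.1] == 1].

Record cpair := CPair {
  cpair_val :> gT * gT;
  _ : cpair_val \in commuting_pairs
}.

HB.instance Definition _ := [isSub for cpair_val].
HB.instance Definition _ := [Finite of cpair by <:].

(* On commuting pairs g * k * g^-1 = k, so that the second identification
   reads (g, k) ~ (k, g^-1). *)
Definition identified (x y : cpair) : Prop :=
  let: (g, k) := val x in
  (exists m : int, val y = (g, k * expgz g m))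
  \/ val y = (g * k * g^-1, g^-1).

(* Edges are undirected, hence the symmetrization. *)
Definition edge : rel cpair :=
  fun x y => `[< identified x y \/ identified y x >].

Lemma edge_sym : symmetric edge.
Proof. by move=> x y; apply: asbool_equiv_eq; rewrite or_comm. Qed.

(* This is the condition under which n_comp counts connected components. *)
Lemma edge_connect_sym : connect_sym edge.
Proof. exact/sym_connect_sym/edge_sym. Qed.

Definition r1 : nat := n_comp edge predT.

End CommutingPairs.

(* Main.v *)
(* A matrix with rows (a, b) and (c, d) acts by
   (g, k) |-> (g^a k^b, g^c k^d).  The edges of the graph are the actions of the
   lower unitriangular matrices and of S, so components lie inside orbits.
   Conversely, the Euclidean algorithm on the first column of A, with a
   unitriangular step followed by S, joins A x to x by a path. *)
Require Import Defs.
From mathcomp Require Import all_boot all_order all_algebra all_fingroup.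
From mathcomp Require Import boolp ring zify.

Set Implicit Arguments.
Unset Strict Implicit.
Unset Printing Implicit Defensive.

Import GRing.Theory.

Local Open Scope group_scope.

Section IntegerPowers.
Variable gT : groupType.
Implicit Types (x y : gT) (m n : int).

Lemma expgz1 x : expgz x 1 = x.
Proof. exact: expg1. Qed.

Lemma expgzS x m : expgz x (m + 1)%R = expgz x m * x.
Proof.
case: m => [n|[|n]].
- by rewrite (_ : (Posz n + 1)%R = Posz n.+1) /= ?expgSr //; lia.
(* Since [Negz n] encodes -(n+1), [Negz 0] is the one case where the exponent leaves the negative
   range. *)
- by rewrite /= expg1 mulVg.
rewrite (_ : (Negz n.+1 + 1)%R = Negz n); last by lia.
by rewrite /= [x ^+ n.+2]expgS invMg mulgKV.
Qed.

Lemma expgzB1 x m : expgz x (m - 1)%R = expgz x m * x^-1.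
Proof. by rewrite -{2}[m](subrK 1%R) expgzS mulgK. Qed.

Lemma expgzD x m n : expgz x (m + n)%R = expgz x m * expgz x n.
Proof.
elim/int_ind: n => [|n IHn|n IHn].
- by rewrite addr0 mulg1.
- by rewrite intS [(1 + _)%R]addrC addrA !expgzS IHn mulgA.
- by rewrite intS [(1 + _)%R]addrC opprD addrA !expgzB1 IHn mulgA.
Qed.

Lemma expgzN x m : expgz x (- m)%R = (expgz x m)^-1.
Proof. by apply: (mulgI (expgz x m)); rewrite -expgzD subrr mulgV. Qed.

Lemma expgzM x m n : expgz x (m * n)%R = expgz (expgz x m) n.
Proof.
elim/int_ind: n => [|n IHn|n IHn].
- by rewrite mulr0.
- by rewrite intS addrC expgzS mulrDr mulr1 expgzD IHn.
- by rewrite intS addrC opprD expgzB1 mulrBr mulr1 expgzD expgzN IHn.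
Qed.

Lemma commute_expgz x y m : commute x y -> commute x (expgz y m).
Proof.
move=> cxy; case: m => n; rewrite /=; last apply: commuteV; exact: commuteX.
Qed.

Lemma commute_expgz2 x y m n :
  commute x y -> commute (expgz x m) (expgz y n).
Proof.
by move=> cxy; apply/commute_expgz/commute_sym/commute_expgz/commute_sym.
Qed.

(** For a negative exponent the inverse reverses the product, and commutation of the powers restores
    the order. *)
Lemma expgzMl x y m :
  commute x y -> expgz (x * y) m = expgz x m * expgz y m.
Proof.
case: m => n cxy /=; first exact: expgMn.
rewrite expgMn // (_ : commute (x ^+ n.+1) (y ^+ n.+1)) ?invMg //.
exact: commuteX2.
Qed.

End IntegerPowers.

Lemma expgz_in (gT : finGroupType) (G : {group gT}) (x : gT) (m : int) :
  x \in G -> expgz x m \in G.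
Proof. by case: m => n Gx; rewrite /= ?groupV groupX. Qed.

(** By hypothesis orbits are connectivity classes; each class contains exactly one canonical root,
    and [n_comp] counts these roots. *)
Lemma num_orbits_n_comp (aT : groupType) (T : finType) (to : aT -> T -> T)
    (e : rel T) :
  connect_sym e -> (forall x y, connect e x y <-> exists a, y = to a x) ->
  num_orbits to = n_comp e predT.
Proof.
move=> sym_e orbitE; pose cls x := [set y | connect e x y].
have clsE x : [set y | `[< exists a, y = to a x >]] = cls x.
  apply/setP=> y; rewrite !inE.
  by apply/asboolP/idP => /orbitE.
rewrite /num_orbits (eq_imset _ clsE).
have cls_root x : cls (fingraph.root e x) = cls x.
  by apply/setP=> y; rewrite !inE -(same_connect sym_e (connect_root e x)).
have -> : [set cls x | x : T] = [set cls x | x in roots e].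
  apply/setP=> A; apply/imsetP/imsetP => [[x _ ->]|[x _ ->]]; last by exists x.
  by exists (fingraph.root e x); [exact: roots_root | rewrite cls_root].
rewrite card_in_imset; first by apply: eq_card => x; rewrite !inE andbT.
(* Two roots with the same class are connected, so they have the same root; each being its own root,
   they coincide. *)
move=> x y /eqP rx /eqP ry eq_cls.
have : y \in cls x by rewrite eq_cls inE connect0.
by rewrite inE -(root_connect sym_e) rx ry => /eqP.
Qed.

Lemma mx2_eta (R : Type) (A : 'M[R]_2) :
  A = mx2 (A ord0 ord0) (A ord0 ord_max) (A ord_max ord0) (A ord_max ord_max).
Proof.
apply/matrixP=> i j; rewrite mxE.
by case: i j => [[|[|i]] lti] [[|[|j]] ltj] //=; congr (A _ _); apply: val_inj.
Qed.

Lemma mulmx2E (R : pzSemiRingType) (A B : 'M[R]_2) i j :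
  (A *m B)%R i j = (A i ord0 * B ord0 j + A i ord_max * B ord_max j)%R.
Proof.
by rewrite mxE !big_ord_recl big_ord0 addr0; congr (_ + A _ _ * B _ _)%R;
  apply: val_inj.
Qed.

Lemma SL2Z_det_entries (A : SL2Z) :
  (A ord0 ord0 * A ord_max ord_max - A ord0 ord_max * A ord_max ord0)%R = 1%R.
Proof. by rewrite -det_mx2 -mx2_eta SL2Z_det. Qed.

Fact SL2Z_Tz_subproof (m : int) : (\det (mx2 1 0 m 1 : 'M[int]_2) == 1)%R.
Proof. by rewrite det_mx2 mul1r mul0r subr0. Qed.

(** This is the m-th power of [SL2Z_T], written as an explicit matrix so that an edge with arbitrary
    m is the action of one known element. *)
Definition SL2Z_Tz (m : int) : SL2Z := MkSL2Z (SL2Z_Tz_subproof m).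

Section Action.
Variables (gT : finGroupType) (G : {group gT}).
Implicit Types (x y : cpair G) (A B : SL2Z).

Lemma cpairP x : [/\ x.1 \in G, x.2 \in G & commute x.1 x.2].
Proof.
case: x => [[g k]] /= /[!inE] /andP[/andP[Gg Gk]] /commgP ckg.
by split=> //; exact: commute_sym.
Qed.

Fact SL2Z_act_subproof A x :
  (expgz x.1 (A ord0 ord0) * expgz x.2 (A ord0 ord_max),
   expgz x.1 (A ord_max ord0) * expgz x.2 (A ord_max ord_max))
    \in commuting_pairs G.
Proof.
have [Gg Gk cgk] := cpairP x.
rewrite !inE /= !groupM ?expgz_in //=; apply/commgP/commute_sym.
by apply: commuteM; apply/commute_sym/commuteM;
  apply: commute_expgz2 => //; apply: commute_sym.
Qed.

Definition SL2Z_act A x : cpair G := CPair (SL2Z_act_subproof A x).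

(** Written additively, the action multiplies the column (g, k) by the matrix on the left, so
    compatibility with products is associativity of matrix multiplication. *)
Lemma SL2Z_act_is_left_action : is_left_action SL2Z_act.
Proof.
split=> [x|A B x]; apply: val_inj => /=.
  rewrite !mxE /= expg0 !expg1 mulg1 mul1g.
  by case: (val x).
have [_ _ cgk] := cpairP x.
(* Here (a, b) stands for either row of [A], so both components follow from one identity. *)
have rowE (a b : int) :
  expgz x.1 (a * B ord0 ord0 + b * B ord_max ord0)%R *
  expgz x.2 (a * B ord0 ord_max + b * B ord_max ord_max)%R =
  expgz (expgz x.1 (B ord0 ord0) * expgz x.2 (B ord0 ord_max)) a *
  expgz (expgz x.1 (B ord_max ord0) * expgz x.2 (B ord_max ord_max)) b.
  rewrite !expgzMl; try exact: commute_expgz2.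
  rewrite -!expgzM ![(_ * a)%R]mulrC ![(_ * b)%R]mulrC !expgzD.
  rewrite !mulgA; congr (_ * _); rewrite -!mulgA; congr (_ * _).
  (* What remains is to swap the two middle factors, a power of [x.1] and a power of [x.2]. *)
  exact: commute_expgz2.
by rewrite !mulmx2E !rowE.
Qed.

Lemma SL2Z_act_Tz m x :
  SL2Z_act (SL2Z_Tz m) x = (x.1, x.2 * expgz x.1 m) :> gT * gT.
Proof.
have [_ _ cgk] := cpairP x.
rewrite /= !mxE /= expg0 !expg1 mulg1; congr (_, _).
exact/commute_sym/commute_expgz/commute_sym.
Qed.

Lemma SL2Z_act_T x : SL2Z_act SL2Z_T x = (x.1, x.2 * x.1) :> gT * gT.
Proof. by rewrite -[X in (_, _ * X)]expgz1 -SL2Z_act_Tz. Qed.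

Lemma SL2Z_act_S x : SL2Z_act SL2Z_S x = (x.2, x.1^-1) :> gT * gT.
Proof. by rewrite /= !mxE /= expg0 !expg1 mul1g mulg1. Qed.

Lemma identified_act x y :
  identified x y <->
  (exists m, y = SL2Z_act (SL2Z_Tz m) x) \/ y = SL2Z_act SL2Z_S x.
Proof.
have [_ _ cgk] := cpairP x.
have conjgk : x.1 * x.2 * x.1^-1 = x.2 by rewrite cgk mulgK.
rewrite /identified [val x]surjective_pairing conjgk.
split=> [[[m]|]|[[m ->]|->]].
- by rewrite -SL2Z_act_Tz => /val_inj ->; left; exists m.
- by rewrite -SL2Z_act_S => /val_inj ->; right.
- by left; exists m; exact: SL2Z_act_Tz.
- by right; exact: SL2Z_act_S.
Qed.

Lemma connect_act_Tz m x : connect (@edge gT G) x (SL2Z_act (SL2Z_Tz m) x).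
Proof.
by apply/connect1/asboolP; left; apply/identified_act; left; exists m.
Qed.

Lemma connect_act_S x : connect (@edge gT G) x (SL2Z_act SL2Z_S x).
Proof. by apply/connect1/asboolP; left; apply/identified_act; right. Qed.

Lemma connect_act A x : connect (@edge gT G) x (SL2Z_act A x).
Proof.
have [act1 actM] := SL2Z_act_is_left_action.
have [n] := ubnP (absz (A ord0 ord0)); elim: n A => // n IHn A leAn.
have := SL2Z_det_entries A.
have [a0|a_neq0] := eqVneq (A ord0 ord0) 0%R.
  rewrite a0 mul0r sub0r => detA.
  (* If a = 0, then b = -c is a unit and A = T^(bd) S^b. *)
  have [[b1 c1]|[b1 c1]] :
      A ord0 ord_max = 1%R /\ A ord_max ord0 = (-1)%R \/
      A ord0 ord_max = (-1)%R /\ A ord_max ord0 = 1%R.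
    have := detA; rewrite -mulNr => /intUnitRing.unitzPl /orP[] /eqP c1;
      by move: detA; rewrite c1; lia.
    suff -> : A = SL2Z_Tz (A ord_max ord_max) * SL2Z_S.
      rewrite actM; apply: connect_trans (connect_act_S _) _.
      exact: connect_act_Tz.
    apply: val_inj; rewrite /= (mx2_eta (val A)) [RHS]mx2_eta !mulmx2E !mxE /=.
    rewrite a0 b1 c1; congr mx2; ring.
  (* [SL2Z_S] has order 4, so its cube is its inverse; the cube is a path of three forward edges. *)
  suff -> : A = SL2Z_Tz (- A ord_max ord_max)%R * (SL2Z_S * (SL2Z_S * SL2Z_S)).
    rewrite !actM; apply: connect_trans (connect_act_S _) _.
    apply: connect_trans (connect_act_S _) _.
    apply: connect_trans (connect_act_S _) _.
    exact: connect_act_Tz.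
  apply: val_inj; rewrite /= (mx2_eta (val A)) [RHS]mx2_eta !mulmx2E !mxE /=.
  rewrite a0 b1 c1; congr mx2; ring.
move=> _; pose q := (A ord_max ord0 %/ A ord0 ord0)%Z.
apply: (@connect_trans _ _ (SL2Z_act (SL2Z_S * (SL2Z_Tz (- q)%R * A)) x)).
  (* The unitriangular factor replaces c by c - qa, the remainder of c modulo a, and [SL2Z_S] moves
     it to the top left corner, where its absolute value is below that of a. *)
  apply: IHn; rewrite /= !mulmx2E !mxE /=.
  have := ltz_mod (A ord_max ord0) a_neq0.
  have := modz_ge0 (A ord_max ord0) a_neq0.
  rewrite /modz -/q.
  set a := A ord0 ord0 in a_neq0 leAn *; set c := A ord_max ord0; lia.
(* The reduction step is a path starting at the image of [x] under [A], hence the reversal. *)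
rewrite edge_connect_sym !actM.
exact: connect_trans (connect_act_Tz _ _) (connect_act_S _).
Qed.

Lemma connect_orbit x y :
  connect (@edge gT G) x y <-> exists A, y = SL2Z_act A x.
Proof.
have [act1 actM] := SL2Z_act_is_left_action.
split=> [/connectP[p + ->]|[A ->]]; last exact: connect_act.
elim: p x => [|z p IHp] x /=; first by exists 1; rewrite act1.
case/andP=> /asboolP exz /IHp[A ->].
suff [B ->] : exists B, z = SL2Z_act B x by exists (A * B); rewrite actM.
(* An edge traversed backwards acts by the inverse matrix, which gives the last two of the four
   cases. *)
case: exz => /identified_act[[m]|] ->.
- by exists (SL2Z_Tz m).
- by exists SL2Z_S.
- by exists (SL2Z_Tz m)^-1; rewrite -actM mulVg act1.
- by exists SL2Z_S^-1; rewrite -actM mulVg act1.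
Qed.

End Action.

Theorem proposition3 (gT : finGroupType) (G : {group gT}) :
  exists to : SL2Z -> cpair G -> cpair G,
    [/\ is_left_action to,
        forall x : cpair G,
          to SL2Z_T x = (x.1, x.2 * x.1) :> gT * gT,
        forall x : cpair G,
          to SL2Z_S x = (x.2, x.1^-1) :> gT * gT
      & num_orbits to = r1 G].
Proof.
exists (@SL2Z_act gT G); split.
- exact: SL2Z_act_is_left_action.
- exact: SL2Z_act_T.
- exact: SL2Z_act_S.
- exact: num_orbits_n_comp (@edge_connect_sym gT G) (@connect_orbit gT G).
Qed.
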